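(* Let $G$ be a finite group acting on a complex abelian variety $A$, and let $H\le G$. Let $H_1=H,H_2,\dots,H_s$ be the double cosets of $H$ in $G$, and $q_i:=\frac1{|H|}\sum_{y\in H_i}y$. Let $V$ be an irreducible complex representation of $G$ with $\dim V^H=1$ and $\chi_V$ rational-valued, and let $W$ be the associated irreducible rational representation. Then each $\chi_V(q_i)$ is an integer, each $q_i$ is an endomorphism of $A_H$, and $$A_{H,\widetilde W}=\{z\in A_H:\ q_i(z)=\chi_V(q_i)\,z\ \text{ for } i=1,\dots,s\}_0.$$
   Context: The action of $G$ on $A$ induces an algebra homomorphism $\mathbb{Q}[G]\to\mathrm{End}_{\mathbb Q}(A)$. Elements of $\mathbb{Q}[G]$ are identified with their images. For $\alpha\in\mathrm{End}_{\mathbb Q}(A)$, take any positive integer $n$ with $n\alpha\in\mathrm{End}(A)$ and set $\mathrm{Im}(\alpha):=\mathrm{Im}(n\alpha)$. This does not depend on $n$. Set $p_H:=\frac1{|H|}\sum_{h\in H}h$ and $A_H:=\mathrm{Im}(p_H)$; $p_H$ acts as the identity on $A_H$. $\chi_V$ is extended linearly to $\mathbb{Q}[G]$. Define $e_W:=\frac{\dim V}{|G|}\sum_{g}\chi_V(g^{-1})g$, $f_{H,\widetilde W}:=p_He_W$, and $A_{H,\widetilde W}:=\mathrm{Im}(f_{H,\widetilde W})$. $\{z\in A_H:\dots\}_0$ denotes the connected component containing $0$ of the indicated subset. *)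

(* Defs.v *)
From HB Require Import structures.
From mathcomp Require Import all_boot all_order all_algebra all_fingroup all_solvable.
From mathcomp Require Import all_field all_character.
From mathcomp Require Import all_classical all_reals all_analysis.

Set Implicit Arguments.
Unset Strict Implicit.
Unset Printing Implicit Defensive.

Import Order.TTheory GRing.Theory Num.Theory.
Import numFieldNormedType.Exports.
Local Open Scope ring_scope.
Local Open Scope classical_set_scope.

(* A complex torus of dimension g is C^g / Lambda; choosing a Z-basis of     *)
(* Lambda it is R^n / Z^n (n = 2g) with the complex structure J : R^n -> R^n *)
(* (J^2 = -1).  Points of A are column vectors of R^n taken modulo Z^n;      *)
(* subsets of A are represented by Z^n-invariant subsets of R^n.             *)

Section Torus.
Variables (R : realType) (n : nat).

Definition lattice : set 'cV[R]_n := [set x | forall i, x i 0 \is a Num.int].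

Definition eqA (x y : 'cV[R]_n) : Prop := lattice (x - y).

Definition lat_inv (S : set 'cV[R]_n) : Prop :=
  forall x y, eqA x y -> S x -> S y.

(* connectedness in A for the quotient topology: the open sets of A are the *)
(* lattice-invariant open subsets of R^n                                    *)
Definition connectedA (C : set 'cV[R]_n) : Prop :=
  forall U1 U2 : set 'cV[R]_n,
    lat_inv U1 -> lat_inv U2 -> @open 'cV[R]_n U1 -> @open 'cV[R]_n U2 ->
    C `<=` U1 `|` U2 -> C `&` U1 `&` U2 = set0 ->
    C `<=` U1 \/ C `<=` U2.

Definition component0 (S : set 'cV[R]_n) : set 'cV[R]_n :=
  \bigcup_(C in [set C | C `<=` S /\ lat_inv C /\ C 0 /\ connectedA C]) C.

Definition intmxR (M : 'M[int]_n) : 'M[R]_n := map_mx (fun z : int => z%:~R) M.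
Definition ratmxR (M : 'M[rat]_n) : 'M[R]_n := map_mx (fun q : rat => ratr q) M.

(* A = R^n/Z^n with complex structure J is an abelian variety: it admits a  *)
(* Riemann form (polarization) E, an integral alternating form on Z^n with  *)
(* E(Jx,Jy) = E(x,y) and E(Jx,x) > 0 for x <> 0.                           *)
Definition complex_structure (J : 'M[R]_n) : Prop := J *m J = - 1%:M.

Definition is_abelian_variety (J : 'M[R]_n) : Prop :=
  complex_structure J /\
  exists E : 'M[int]_n,
    E^T = - E /\
    J^T *m intmxR E *m J = intmxR E /\
    forall x : 'cV[R]_n, x != 0 -> 0 < ((J *m x)^T *m intmxR E *m x) 0 0.

Definition is_endo (J : 'M[R]_n) (M : 'M[int]_n) : Prop :=
  intmxR M *m J = J *m intmxR M.

(* a positive integer k with k * alpha integral: product of denominators *)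
Definition den_mx (a : 'M[rat]_n) : nat :=
  (\prod_(i < n) \prod_(j < n) `|denq (a i j)|%N)%N.

(* Im(alpha) for alpha in End_Q(A) : the image in A of k*alpha, with k a    *)
(* positive integer such that k*alpha is an endomorphism of A.              *)
Definition ImQ (a : 'M[rat]_n) : set 'cV[R]_n :=
  [set y | exists x : 'cV[R]_n, eqA y (ratmxR ((den_mx a)%:R *: a) *m x)].

Definition tangentQ (a : 'M[rat]_n) : set 'cV[R]_n :=
  [set u | exists x : 'cV[R]_n, u = ratmxR a *m x].

End Torus.

Section GroupAlg.
Variables (gT : finGroupType) (n : nat) (rho : gT -> 'M[int]_n).

Definition rhoQ (g : gT) : 'M[rat]_n := map_mx (fun z : int => z%:~R) (rho g).

Definition pH (H : {set gT}) : 'M[rat]_n :=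
  (#|H|%:R)^-1 *: \sum_(h in H) rhoQ h.

Definition qD (H D : {set gT}) : 'M[rat]_n :=
  (#|H|%:R)^-1 *: \sum_(y in D) rhoQ y.

(* e_W = dim V / |G| sum_g chi_V(g^-1) g, with c the rational values of chi_V *)
Definition eW (G : {set gT}) (c : gT -> rat) : 'M[rat]_n :=
  (c 1%g / #|G|%:R) *: \sum_(g in G) c (g^-1)%g *: rhoQ g.

Definition fHW (G H : {set gT}) (c : gT -> rat) : 'M[rat]_n := pH H *m eW G c.

End GroupAlg.

Definition dcosets (gT : finGroupType) (H G : {set gT}) : {set {set gT}} :=
  ([set ((H :* x) * H)%g | x in G])%SET.

(* Main.v *)
Require Import Defs.
From HB Require Import structures.
From mathcomp Require Import all_boot all_order all_algebra all_fingroup all_solvable.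
From mathcomp Require Import all_field all_character.
From mathcomp Require Import all_classical all_reals all_analysis.
Import Order.TTheory GRing.Theory Num.Theory.
Import numFieldNormedType.Exports.
Local Open Scope ring_scope.
Local Open Scope classical_set_scope.

Set Implicit Arguments.
Unset Strict Implicit.
Unset Printing Implicit Defensive.

(* The projection onto V^H has rank one, so each q_D acts on V^H by the scalar
   lambda_D = chi_V(q_D); these scalars are eigenvalues of matrices with entries
   0 and 1, hence rational algebraic integers.  It follows that
   q_D f = lambda_D f for f = p_H e_W.  Conversely f is a combination
   sum_D b_D q_D, and orthogonality of characters gives sum_D b_D lambda_D = 1,
   so that f - 1 = sum_D b_D (q_D - lambda_D).  A multiple B of f - 1 is
   therefore integral and maps the solution set S into Z^n; the class of B y
   modulo B Z^n is locally constant on S, so it vanishes on the component of 0,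
   where y then lies in ker (f - 1) + Z^n, that is, in the image of f. *)

(** * Double cosets and sums of [H]-invariant functions *)

Lemma dcosetP (gT : finGroupType) (H G : {group gT}) (D : {set gT}) :
  H \subset G -> D \in dcosets H G ->
  [/\ D \subset G,
      forall h y, h \in H -> (h * y \in D)%g = (y \in D) &
      forall h y, h \in H -> (y * h \in D)%g = (y \in D)].
Proof.
move=> sHG /imsetP[x Gx ->]; split.
- by rewrite !mul_subG // finset.sub1set.
- have HD : (H * ((H :* x) * H) = (H :* x) * H)%g by rewrite !mulgA mulGid.
  move=> h y Hh; apply/idP/idP => [hyD|yD]; rewrite -HD.
    by rewrite -(mulKg h y) mem_mulg ?groupV.
  by rewrite mem_mulg.
- have DH : ((H :* x) * H * H = (H :* x) * H)%g by rewrite -mulgA mulGid.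
  move=> h y Hh; apply/idP/idP => [hyD|yD]; rewrite -DH.
    by rewrite -(mulgK h y) mem_mulg ?groupV.
  by rewrite mem_mulg.
Qed.

Lemma dcoset_same (gT : finGroupType) (H : {group gT}) (x k : gT) :
  (k \in (H :* x) * H)%g = ((H :* k) * H == (H :* x) * H)%g.
Proof.
apply/idP/eqP => [|<-]; last first.
  by apply/mulsgP; exists k 1%g; rewrite ?rcoset_refl ?mulg1.
case/mulsgP=> _ h2 /rcosetP[h1 Hh1 ->] Hh2 ->.
by rewrite !rcosetM (rcoset_id Hh1) -mulgA (lcoset_id Hh2).
Qed.

(** [T] holds one representative of each left coset of [H] inside [D]. It turns averages with
    denominator [#|H|] into integral sums, and the same [T] serves every [F]. *)
Lemma sum_right_invariant (gT : finGroupType) (H : {group gT}) (D : {set gT}) :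
  (forall h y, h \in H -> (y * h \in D)%g = (y \in D)) ->
  exists2 T : {set gT}, T \subset D &
    forall (V : nmodType) (F : gT -> V),
      (forall h y, h \in H -> y \in D -> F (y * h)%g = F y) ->
      \sum_(y in D) F y = (\sum_(t in T) F t) *+ #|H|.
Proof.
move=> DH; pose r (y : gT) := repr (y *: H)%g.
have rP y : exists2 h, h \in H & r y = (y * h)%g.
  by have /lcosetP := mem_repr _ (lcoset_refl H y).
have rH h y : h \in H -> r (y * h)%g = r y.
  by move=> Hh; rewrite /r lcosetM lcoset_id.
exists [set r y | y in D]%SET.
  by apply/fintype.subsetP=> _ /imsetP[y yD ->]; have [h Hh ->] := rP y; rewrite DH.
move=> V F FH.
rewrite (partition_big_imset r) /= -sumrMnl; apply: eq_bigr => t /imsetP[x xD tx].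
have [h0 Hh0 rx] := rP x.
transitivity (\sum_(y in (x *: H)%g) F t).
  apply: eq_big => [y|y /andP[yD /eqP ry]].
    apply/andP/idP.
      case=> yD /eqP ry; have [h Hh ryh] := rP y.
      apply/lcosetP; exists (h0 * h^-1)%g; first by rewrite groupM ?groupV.
      by rewrite mulgA -rx -tx -ry ryh mulgK.
    by case/lcosetP=> h Hh ->; rewrite DH// rH// tx.
  by have [h Hh ryh] := rP y; rewrite -ry ryh FH.
by rewrite sumr_const card_lcoset.
Qed.

(** * Rank-one projections and averages over [H] *)

(** A nonzero row [v] of [E] spans its row space, so [P = l *m v] with [v *m l = 1], and
    [Q = P *m Q *m P] is a multiple of [P]. As [P] has trace 1, the factor is the trace of [Q]. *)
Lemma rank1_proj (F : fieldType) m k (P : 'M[F]_m) (E : 'M[F]_(k, m)) :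
  \rank E = 1%N -> E *m P = E -> (P <= E)%MS ->
  \tr P = 1 /\ forall Q, P *m Q = Q -> Q *m P = Q -> Q = \tr Q *: P.
Proof.
move=> rE EP PE.
pose v := nz_row E.
have v0 : v != 0 by rewrite nz_row_eq0 -mxrank_eq0 rE.
have vE : (v <= E)%MS := nz_row_sub E.
have Ev : (E <= v)%MS.
  by rewrite -(mxrank_leqif_sup vE).2 rE rank_rV v0.
have vP : v *m P = v by have /submxP[w ->] := vE; rewrite -mulmxA EP.
have /submxP[l Pl] := submx_trans PE Ev.
have vl : v *m l = 1%:M.
  have : (v *m l) *m v = v by rewrite -mulmxA -Pl.
  rewrite [v *m l]mx11_scalar mul_scalar_mx => /eqP.
  rewrite -subr_eq0 -[X in _ - X]scale1r -scalerBl scaler_eq0 (negPf v0) orbF subr_eq0.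
  by move=> /eqP ->.
have trP : \tr P = 1 by rewrite Pl mxtrace_mulC vl mxtrace1.
split=> // Q PQ QP.
have QE : Q = (v *m Q *m l) 0 0 *: P.
  have Q3 : P *m Q *m P = Q by rewrite PQ QP.
  rewrite -{1}Q3.
  have -> : P *m Q *m P = l *m (v *m Q *m l) *m v by rewrite Pl !mulmxA.
  by rewrite {1}[v *m _ *m _]mx11_scalar mul_mx_scalar -scalemxAl -Pl.
by rewrite {2}QE mxtraceZ trP mulr1.
Qed.

Lemma avg_const (F : numFieldType) (V : lmodType F) (gT : finGroupType)
    (H : {group gT}) (x : V) : (#|H|%:R^-1 : F) *: (x *+ #|H|) = x.
Proof.
rewrite -[x *+ _]scaler_nat scalerA mulVf ?scale1r//.
by rewrite pnatr_eq0 -lt0n cardG_gt0.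
Qed.

(** Left translation by [h] permutes [D], so each [r h] fixes the sum over [D]. *)
Lemma avg_mull (F : numFieldType) (gT : finGroupType) (G H : {group gT})
    (D : {set gT}) m (r : gT -> 'M[F]_m) :
  H \subset G -> D \subset G -> {in G &, forall x y, r (x * y)%g = r x *m r y} ->
  (forall h y, h \in H -> (h * y \in D)%g = (y \in D)) ->
  (#|H|%:R^-1 *: \sum_(h in H) r h) *m (\sum_(y in D) r y) = \sum_(y in D) r y.
Proof.
move=> sHG sDG rM HD; rewrite -scalemxAl mulmx_suml.
rewrite (eq_bigr (fun=> \sum_(y in D) r y)) => [|h Hh].
  by rewrite sumr_const avg_const.
rewrite mulmx_sumr [RHS](reindex_inj (mulgI h)) /=; apply: eq_big => [y|y yD].
  by rewrite HD.
have [Gh Gy] := (fintype.subsetP sHG h Hh, fintype.subsetP sDG y yD).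
by rewrite rM.
Qed.

Lemma avg_mulr (F : numFieldType) (gT : finGroupType) (G H : {group gT})
    (D : {set gT}) m (r : gT -> 'M[F]_m) :
  H \subset G -> D \subset G -> {in G &, forall x y, r (x * y)%g = r x *m r y} ->
  (forall h y, h \in H -> (y * h \in D)%g = (y \in D)) ->
  (\sum_(y in D) r y) *m (#|H|%:R^-1 *: \sum_(h in H) r h) = \sum_(y in D) r y.
Proof.
move=> sHG sDG rM DH; rewrite -scalemxAr mulmx_sumr.
rewrite (eq_bigr (fun=> \sum_(y in D) r y)) => [|h Hh].
  by rewrite sumr_const avg_const.
rewrite mulmx_suml [RHS](reindex_inj (mulIg h)) /=; apply: eq_big => [y|y yD].
  by rewrite DH.
have [Gh Gy] := (fintype.subsetP sHG h Hh, fintype.subsetP sDG y yD).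
by rewrite rM.
Qed.

(** * Character sums over double cosets *)

Lemma chi_trace (gT : finGroupType) (G : {group gT}) (i : Iirr G) g :
  g \in G -> 'chi_i g = \tr ('Chi_i g).
Proof. by move=> Gg; rewrite -irrRepr cfunE Gg mulr1n. Qed.

(* The projection onto the H-invariants has rank one, so it absorbs a double
   coset average up to a scalar, and that scalar is the trace of the average. *)
Lemma chi_dcoset (gT : finGroupType) (G H : {group gT}) (i : Iirr G) :
  H \subset G -> \rank (rfix_mx 'Chi_i H) = 1%N ->
  #|H|%:R^-1 * \sum_(h in H) 'chi_i h = 1 /\
  forall (D : {set gT}) (g : gT), D \in dcosets H G -> g \in G ->
    #|H|%:R^-1 * \sum_(y in D) 'chi_i (g * y)%g =
    (#|H|%:R^-1 * \sum_(y in D) 'chi_i y) *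
    (#|H|%:R^-1 * \sum_(h in H) 'chi_i (g * h)%g).
Proof.
move=> sHG rk1.
have rM := @repr_mxM _ _ _ _ 'Chi_i.
pose S (X : {set gT}) := #|H|%:R^-1 *: \sum_(y in X) 'Chi_i y.
have trS (X : {set gT}) x : X \subset G -> x \in G ->
    #|H|%:R^-1 * \sum_(y in X) 'chi_i (x * y)%g = \tr ('Chi_i x *m S X).
  move=> sXG Gx; rewrite -scalemxAr mxtraceZ mulmx_sumr raddf_sum /=.
  congr (_ * _); apply: eq_bigr => y /(fintype.subsetP sXG) Gy.
  by rewrite chi_trace ?groupM// rM.
(* Vectors are rows: [HP] puts the row space of [S H] inside the [H]-fixed vectors, and [EP] says
   that [S H] fixes these. *)
have HP h : h \in H -> S H *m 'Chi_i h = S H.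
  move=> Hh; rewrite -scalemxAl mulmx_suml; congr (_ *: _).
  rewrite [RHS](reindex_inj (mulIg h)) /=; apply: eq_big => [y|y yH].
    by rewrite groupMr.
  by rewrite rM ?(fintype.subsetP sHG).
have EP : rfix_mx 'Chi_i H *m S H = rfix_mx 'Chi_i H.
  rewrite -scalemxAr mulmx_sumr (eq_bigr _ (fun h => @rfix_mx_id _ _ _ _ _ _ h)).
  by rewrite sumr_const avg_const.
have PE : (S H <= rfix_mx 'Chi_i H)%MS by apply/rfix_mxP.
have trS1 (X : {set gT}) : X \subset G ->
    #|H|%:R^-1 * \sum_(y in X) 'chi_i y = \tr (S X).
  move=> sXG; rewrite -[S X]mul1mx -(repr_mx1 'Chi_i) -trS//.
  by congr (_ * _); apply: eq_bigr => y _; rewrite mul1g.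
have [trP SE] := rank1_proj rk1 EP PE.
split=> [|D g /(dcosetP sHG)[sDG HD DH] Gg]; first by rewrite trS1.
have PQ : S H *m S D = S D by rewrite -scalemxAr (avg_mull sHG sDG rM HD).
have QP : S D *m S H = S D by rewrite -scalemxAl (avg_mulr sHG sDG rM DH).
by rewrite !trS// trS1// {1}(SE _ PQ QP) -scalemxAr mxtraceZ.
Qed.

Lemma avg_constr (F : numFieldType) (gT : finGroupType) (H : {group gT}) (x : F) :
  #|H|%:R^-1 * (x *+ #|H|) = x.
Proof. by rewrite -[x *+ _]mulr_natl mulKf// pnatr_eq0 -lt0n cardG_gt0. Qed.

(** Eigenvalues of integral matrices are algebraic integers. The operator here is the sum of the
    right translations by a transversal [T] of [D], acting on functions on [gT]. *)
Lemma chi_dcoset_Aint (gT : finGroupType) (G H : {group gT}) (i : Iirr G)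
    (D : {set gT}) :
  H \subset G -> \rank (rfix_mx 'Chi_i H) = 1%N -> D \in dcosets H G ->
  #|H|%:R^-1 * \sum_(y in D) 'chi_i y \in Aint.
Proof.
move=> sHG rk1 DD.
have [w1 wE] := chi_dcoset sHG rk1.
have [sDG _ DH] := dcosetP sHG DD.
have [T sTD TE] := sum_right_invariant DH.
pose w g := #|H|%:R^-1 * \sum_(h in H) 'chi_i (g * h)%g.
have wH h g : h \in H -> w (g * h)%g = w g.
  move=> Hh; congr (_ * _).
  rewrite [RHS](reindex_inj (mulgI h)) /=; apply: eq_big => [y|y yH].
    by rewrite groupMl.
  by rewrite mulgA.
(* The character is 0 outside [G], so [w] is too, and the matrix can be indexed by all of [gT]. *)
have w0 g : g \notin G -> w g = 0.
  move=> nGg; rewrite /w big1 ?mulr0// => h /(fintype.subsetP sHG) Gh.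
  by rewrite cfun0// groupMr.
pose a := #|H|%:R^-1 * \sum_(y in D) 'chi_i y.
(* w is an eigenvector, for the eigenvalue a, of a matrix with entries 0, 1. *)
have aw g : a * w g = \sum_(t in T) w (g * t)%g.
  have [Gg|nGg] := boolP (g \in G); last first.
    rewrite w0// mulr0 big1// => t /(fintype.subsetP sTD)/(fintype.subsetP sDG) Gt.
    by rewrite w0// groupMr.
  rewrite -wE// -[RHS](avg_constr H) -TE; last first.
    by move=> h y Hh _; rewrite mulgA; apply: wH.
  (* Right translation by [h] preserves [D], so the extra average over [H] in [w] changes
     nothing. *)
  congr (_ * _); rewrite /w -mulr_sumr exchange_big /=.
  rewrite [in RHS](eq_bigr (fun=> \sum_(y in D) 'chi_i (g * y)%g)) => [|h Hh].
    by rewrite sumr_const avg_constr.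
  rewrite [RHS](reindex_inj (mulIg h)) /=; apply: eq_big => [y|y yD].
    by rewrite DH.
  by rewrite mulgA.
(* Column [l] marks the elements of [l T], so the row [w] times [M] has as [l]-th entry the sum of
   [w] over [l T]. *)
pose M : 'M[int]_#|gT| := \matrix_(k, l) ((enum_val l)^-1 * enum_val k \in T)%g%:R.
pose MC : 'M[algC]_#|gT| := map_mx intr M.
apply: (@root_monic_Aint (char_poly MC)); last 2 first.
- exact: char_poly_monic.
- rewrite -map_char_poly; apply/polyOverP => k.
  by rewrite coef_map /= rpred_int_num ?intr_int.
rewrite -eigenvalue_root_char; apply/eigenvalueP.
exists (\row_k w (enum_val k)).
  apply/rowP=> l; rewrite !mxE aw.
  rewrite [RHS](reindex_inj (mulgI (enum_val l)^-1%g)) /=.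
  rewrite (reindex_onto enum_rank enum_val) /=; last by move=> ? _; rewrite enum_valK.
  rewrite [RHS]big_mkcond /=; apply: eq_big => [x|x _]; first by rewrite enum_rankK eqxx.
  by rewrite !mxE enum_rankK mulKVg; case: (_ \in T); rewrite ?mulr1 ?mulr0.
apply/eqP=> /rowP/(_ (enum_rank 1%g)); rewrite !mxE enum_rankK => /eqP.
suff -> : w 1%g = 1 by rewrite oner_eq0.
by rewrite /w -[RHS]w1; congr (_ * _); apply: eq_bigr => h _; rewrite mul1g.
Qed.

Lemma chi_dcoset_int (gT : finGroupType) (G H : {group gT}) (i : Iirr G)
    (c : gT -> rat) (D : {set gT}) :
  H \subset G -> \rank (rfix_mx 'Chi_i H) = 1%N ->
  (forall g, g \in G -> ratr (c g) = 'chi_i g) -> D \in dcosets H G ->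
  #|H|%:R^-1 * \sum_(y in D) 'chi_i y \is a Num.int.
Proof.
move=> sHG rk1 hc DD; apply: Cint_rat_Aint; last exact: chi_dcoset_Aint.
have [sDG _ _] := dcosetP sHG DD.
rewrite rpredM ?rpredV ?rpred_nat// rpred_sum// => y /(fintype.subsetP sDG) Gy.
by rewrite -hc// Crat_rat.
Qed.

(** * Rational character values and orthogonality *)

Lemma rat_dcoset (gT : finGroupType) (G H : {group gT}) (i : Iirr G)
    (c : gT -> rat) :
  H \subset G -> \rank (rfix_mx 'Chi_i H) = 1%N ->
  (forall g, g \in G -> ratr (c g) = 'chi_i g) ->
  #|H|%:R^-1 * \sum_(h in H) c h = 1 /\
  forall (D : {set gT}) (g : gT), D \in dcosets H G -> g \in G ->
    #|H|%:R^-1 * \sum_(y in D) c (g * y)%g =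
    (#|H|%:R^-1 * \sum_(y in D) c y) * (#|H|%:R^-1 * \sum_(h in H) c (g * h)%g).
Proof.
move=> sHG rk1 hc; have [w1 wE] := chi_dcoset sHG rk1.
have tr (X : {set gT}) x : X \subset G -> x \in G ->
    ratr (#|H|%:R^-1 * \sum_(y in X) c (x * y)%g) =
    #|H|%:R^-1 * \sum_(y in X) 'chi_i (x * y)%g.
  move=> sXG Gx; rewrite rmorphM fmorphV rmorph_nat rmorph_sum /=.
  by congr (_ * _); apply: eq_bigr => y /(fintype.subsetP sXG) Gy; rewrite hc ?groupM.
have tr1 (X : {set gT}) : X \subset G ->
    ratr (#|H|%:R^-1 * \sum_(y in X) c y) = #|H|%:R^-1 * \sum_(y in X) 'chi_i y.
  by move/tr => /(_ _ (group1 G)); under eq_bigr do rewrite mul1g;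
     under [in RHS]eq_bigr do rewrite mul1g.
have inj := fmorph_inj (ratr : rat -> algC).
split=> [|D g DD Gg]; apply: inj; first by rewrite /= tr1// w1 rmorph1.
have [sDG _ _] := dcosetP sHG DD.
by rewrite [RHS]rmorphM /= !tr// tr1// wE.
Qed.

(** Generalized orthogonality of ['chi_i] with itself, pulled back to the rationals; the prefactor
    is that of [eW]. *)
Lemma rat_orthogonality (gT : finGroupType) (G : {group gT}) (i : Iirr G)
    (c : gT -> rat) (y : gT) :
  (forall g, g \in G -> ratr (c g) = 'chi_i g) -> y \in G ->
  c 1%g / #|G|%:R * \sum_(x in G) c (x * y)%g * c x^-1%g = c y.
Proof.
move=> hc Gy; apply: (fmorph_inj (ratr : rat -> algC)).
rewrite !rmorphM fmorphV rmorph_nat rmorph_sum /= hc// hc//.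
rewrite -mulrA (eq_bigr (fun x => 'chi_i (x * y)%g * 'chi_i x^-1%g)).
  by rewrite generalized_orthogonality_relation eqxx mul1r mulrC divfK// irr1_neq0.
by move=> x Gx; rewrite rmorphM /= !hc ?groupM ?groupV.
Qed.

(** * The elements [pH], [qD] and [eW] of the group algebra *)

Lemma rhoQM (gT : finGroupType) (G : {group gT}) n (rho : gT -> 'M[int]_n) :
  {in G &, forall x y, rho (x * y)%g = rho x *m rho y} ->
  {in G &, forall x y, rhoQ rho (x * y)%g = rhoQ rho x *m rhoQ rho y}.
Proof. by move=> rhoM x y Gx Gy; rewrite /rhoQ rhoM// map_mxM. Qed.

Lemma pH_qD (gT : finGroupType) (G H : {group gT}) n (rho : gT -> 'M[int]_n)
    (D : {set gT}) :
  H \subset G -> {in G &, forall x y, rho (x * y)%g = rho x *m rho y} ->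
  D \in dcosets H G -> pH rho H *m qD rho H D = qD rho H D.
Proof.
move=> sHG /rhoQM rM /(dcosetP sHG)[sDG HD _].
by rewrite /qD -scalemxAr (avg_mull sHG sDG rM HD).
Qed.

Lemma qD_pH (gT : finGroupType) (G H : {group gT}) n (rho : gT -> 'M[int]_n)
    (D : {set gT}) :
  H \subset G -> {in G &, forall x y, rho (x * y)%g = rho x *m rho y} ->
  D \in dcosets H G -> qD rho H D *m pH rho H = qD rho H D.
Proof.
move=> sHG /rhoQM rM /(dcosetP sHG)[sDG _ DH].
by rewrite /qD -scalemxAl (avg_mulr sHG sDG rM DH).
Qed.

Lemma group_dcoset (gT : finGroupType) (H G : {group gT}) :
  (H : {set gT}) \in dcosets H G.
Proof. by apply/imsetP; exists 1%g; rewrite // mulg1 mulGid. Qed.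

(** [D] is a disjoint union of left cosets [t H], so the integral sum over the transversal splits
    off. Where [pH] is the identity, [qD] thus acts by an integral matrix. *)
Lemma qD_transversal (gT : finGroupType) (G H : {group gT}) n
    (rho : gT -> 'M[int]_n) (D : {set gT}) :
  H \subset G -> {in G &, forall x y, rho (x * y)%g = rho x *m rho y} ->
  D \in dcosets H G ->
  exists M : 'M[int]_n, qD rho H D = map_mx intr M *m pH rho H.
Proof.
move=> sHG rhoM DD; have rM := rhoQM rhoM.
have [sDG _ DH] := dcosetP sHG DD.
have [T sTD TE] := sum_right_invariant DH.
exists (\sum_(t in T) rho t).
rewrite -(qD_pH sHG rhoM DD) -scalemxAl mulmx_suml.
rewrite (TE _ (fun y => rhoQ rho y *m pH rho H)) => [|h y Hh yD].
  by rewrite avg_const raddf_sum mulmx_suml.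
rewrite rM ?(fintype.subsetP sDG y yD) ?(fintype.subsetP sHG h Hh)// -mulmxA.
congr (_ *m _); rewrite -scalemxAr mulmx_sumr; congr (_ *: _).
rewrite [RHS](reindex_inj (mulgI h)) /=; apply: eq_big => [z|z zH].
  by rewrite groupMl.
by rewrite rM// (fintype.subsetP sHG).
Qed.

(** The substitution [k = y g] collects the coefficient of [k] in the product. *)
Lemma qD_eW (gT : finGroupType) (G H : {group gT}) n (rho : gT -> 'M[int]_n)
    (c : gT -> rat) (D : {set gT}) :
  {in G &, forall x y, rho (x * y)%g = rho x *m rho y} -> D \subset G ->
  qD rho H D *m eW rho G c =
  (c 1%g / #|G|%:R) *: \sum_(k in G)
    (#|H|%:R^-1 * \sum_(y in D) c (k^-1 * y)%g) *: rhoQ rho k.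
Proof.
move=> rhoM sDG; have rM := rhoQM rhoM.
rewrite /qD /eW -scalemxAr; congr (_ *: _).
rewrite -scalemxAl mulmx_suml.
under [RHS]eq_bigr do rewrite -scalerA scaler_suml.
rewrite -scaler_sumr exchange_big /=; congr (_ *: _); apply: eq_bigr => y yD.
have Gy := fintype.subsetP sDG y yD.
rewrite mulmx_sumr [RHS](reindex_inj (mulgI y)) /=; apply: eq_big => [g|g Gg].
  by rewrite groupMl.
by rewrite -scalemxAr rM// invMg mulgKV.
Qed.

Lemma qD_fHW (gT : finGroupType) (G H : {group gT}) n (rho : gT -> 'M[int]_n)
    (i : Iirr G) (c : gT -> rat) (D : {set gT}) :
  H \subset G -> {in G &, forall x y, rho (x * y)%g = rho x *m rho y} ->
  \rank (rfix_mx 'Chi_i H) = 1%N ->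
  (forall g, g \in G -> ratr (c g) = 'chi_i g) -> D \in dcosets H G ->
  qD rho H D *m fHW rho G H c =
  (#|H|%:R^-1 * \sum_(y in D) c y) *: fHW rho G H c.
Proof.
move=> sHG rhoM rk1 hc DD; have [_ wE] := rat_dcoset sHG rk1 hc.
have [sDG _ _] := dcosetP sHG DD.
rewrite /fHW mulmxA (qD_pH sHG rhoM DD) (qD_eW _ _ rhoM sDG).
(* [pH] is [qD] for [D = H], so both sides become sums over [G] whose coefficients [wE] compares. *)
rewrite (_ : pH rho H = qD rho H H)// (qD_eW _ _ rhoM sHG).
rewrite [RHS]scalerA [X in _ = X *: _]mulrC -[RHS]scalerA; congr (_ *: _).
rewrite scaler_sumr; apply: eq_bigr => k Gk.
by rewrite wE ?groupV// scalerA.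
Qed.

(** A bi-invariant weight is constant on each double coset, and [#|H|%:R] cancels the denominator of
    [qD]. A general [V] covers both the matrices [rhoQ] and the scalars [c]. *)
Lemma sum_dcosets (gT : finGroupType) (G H : {group gT}) (V : lmodType rat)
    (F : gT -> V) (w : gT -> rat) :
  H \subset G ->
  (forall h g, h \in H -> g \in G -> w (g * h)%g = w g) ->
  (forall h g, h \in H -> g \in G -> w (h * g)%g = w g) ->
  \sum_(D in dcosets H G)
     (#|H|%:R * w (repr D)^-1%g) *: ((#|H|%:R^-1 : rat) *: \sum_(k in D) F k) =
  \sum_(k in G) w k^-1%g *: F k.
Proof.
move=> sHG wr wl.
rewrite [RHS](partition_big_imset (fun x => (H :* x) * H)%g) /=.
apply: eq_bigr => D DD; have [sDG HD DH] := dcosetP sHG DD.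
rewrite scalerA mulrAC mulfV ?mul1r; last by rewrite pnatr_eq0 -lt0n cardG_gt0.
rewrite scaler_sumr; case/imsetP: DD => x Gx DE; apply: eq_big => [k|k kD].
  rewrite DE dcoset_same andb_idl// => /eqP kx.
  by apply: (fintype.subsetP sDG); rewrite DE dcoset_same kx.
congr (_ *: _).
have rD : repr D \in D := mem_repr k kD.
have Gr := fintype.subsetP sDG _ rD.
have : k \in ((H :* repr D) * H)%g.
  have /eqP <- : ((H :* k) * H == (H :* repr D) * H)%g.
    move: kD rD; rewrite {1 3}DE !dcoset_same => /eqP -> /eqP ->.
    by rewrite eqxx.
  by rewrite dcoset_same.
case/mulsgP=> _ h2 /rcosetP[h1 Hh1 ->] Hh2 ->.
by rewrite !invMg wl ?wr ?groupM ?groupV ?(fintype.subsetP sHG h1).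
Qed.

(* Orthogonality of characters: e_W is the identity on V. *)
Lemma fHW_comb (gT : finGroupType) (G H : {group gT}) n (rho : gT -> 'M[int]_n)
    (i : Iirr G) (c : gT -> rat) :
  H \subset G -> {in G &, forall x y, rho (x * y)%g = rho x *m rho y} ->
  \rank (rfix_mx 'Chi_i H) = 1%N ->
  (forall g, g \in G -> ratr (c g) = 'chi_i g) ->
  exists2 b : {set gT} -> rat,
    fHW rho G H c = \sum_(D in dcosets H G) b D *: qD rho H D &
    \sum_(D in dcosets H G) b D * (#|H|%:R^-1 * \sum_(y in D) c y) = 1.
Proof.
move=> sHG rhoM rk1 hc; have [w1 wE] := rat_dcoset sHG rk1 hc.
pose w g := #|H|%:R^-1 * \sum_(h in H) c (g * h)%g.
(* The class function property is what makes [w] left invariant as well. *)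
have cJ x y : x \in G -> y \in G -> c (x * y)%g = c (y * x)%g.
  move=> Gx Gy; apply: (fmorph_inj (ratr : rat -> algC)).
  rewrite /= !hc ?groupM// -(cfunJ _ _ Gx) conjgE.
  by rewrite mulgA mulKg.
have wr h g : h \in H -> g \in G -> w (g * h)%g = w g.
  move=> Hh Gg; congr (_ * _).
  rewrite [RHS](reindex_inj (mulgI h)) /=; apply: eq_big => [y|y yH].
    by rewrite groupMl.
  by rewrite mulgA.
have wl h g : h \in H -> g \in G -> w (h * g)%g = w g.
  move=> Hh Gg; congr (_ * _); have Gh := fintype.subsetP sHG h Hh.
  rewrite [RHS](reindex_inj (mulIg h)) /=; apply: eq_big => [y|y yH].
    by rewrite groupMr.
  have Gy := fintype.subsetP sHG y yH.
  by rewrite -mulgA (cJ _ _ Gh (groupM Gg Gy)) mulgA.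
pose k0 := c 1%g / #|G|%:R.
(* By [qD_eW] for [D = H], the coefficient of [k] in [f] is [k0 * w k^-1]; it is constant on [D] and
   read off at [repr D]. *)
exists (fun D => k0 * (#|H|%:R * w (repr D)^-1%g)).
  rewrite /fHW (_ : pH rho H = qD rho H H)// (qD_eW _ _ rhoM sHG).
  under [RHS]eq_bigr do rewrite -scalerA.
  by rewrite -scaler_sumr (sum_dcosets _ sHG wr wl).
under eq_bigr do rewrite -mulrA.
rewrite -mulr_sumr.
have := sum_dcosets (V := rat^o) c sHG wr wl => /= E.
transitivity (k0 * \sum_(k in G) w k^-1%g * c k); first by rewrite -E.
rewrite -w1.
under eq_bigr do rewrite -mulrA mulr_suml.
rewrite -mulr_sumr mulrCA; congr (_ * _).
(* For fixed [h], orthogonality with [x = k^-1] turns the sum over [k] and its prefactor into [c h];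
   what remains is the average of [c] over [H]. *)
rewrite exchange_big mulr_sumr /=; apply: eq_bigr => h Hh.
rewrite -(rat_orthogonality hc (fintype.subsetP sHG h Hh)); congr (_ * _).
rewrite (reindex_inj invg_inj) /=; apply: eq_big => [k|k _]; first by rewrite groupV.
by rewrite invgK.
Qed.

(** * Connected sets and the component of 0 in the torus *)

Lemma open_box (R : realType) n (B : 'M[R]_n) (a : 'cV[R]_n) :
  @open 'cV[R]_n [set y | forall i, `|(B *m y - a) i 0| < 2^-1].
Proof.
rewrite openE => y /= ya; 
  apply: (@filter_forall _ _
    (fun i => [set z : 'cV[R]_n | `|(B *m z - a) i 0| < 2^-1]) (nbhs y)) => i.
have contS (r : seq 'I_n) :
    continuous (fun y : 'cV[R]_n => \sum_(j <- r) B i j * y j 0 : R).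
  elim: r => [|j r IHr] z.
    under eq_fun do rewrite big_nil.
    exact: cst_continuous.
  under eq_fun do rewrite big_cons.
  apply: (@continuousD _ _ _ (fun y : 'cV[R]_n => B i j * y j 0 : R)); last exact: IHr.
  apply: (@continuousM _ _ (fun=> B i j) (fun y : 'cV[R]_n => y j 0)).
    exact: cst_continuous.
  exact: coord_continuous.
have cont : continuous (fun y : 'cV[R]_n => `|(B *m y - a) i 0|).
  have -> : (fun y : 'cV[R]_n => `|(B *m y - a) i 0|) =
      (fun y => `|\sum_j B i j * y j 0 - a i 0|).
    by apply/funext=> z; rewrite !mxE.
  move=> z; apply: (@continuous_comp _ _ _
    (fun y : 'cV[R]_n => \sum_j B i j * y j 0 - a i 0 : R) (@Num.norm R R));
    last exact: norm_continuous.
  apply: (@continuousB _ _ _ (fun y : 'cV[R]_n => \sum_j B i j * y j 0 : R)).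
    exact: contS.
  exact: cst_continuous.
exact: (open_nbhs_nbhs (conj (open_comp (fun x _ => cont x) (@open_lt R 2^-1)) (ya i))).
Qed.

(** The real line [t *: (f *m x)] joins 0 to [f *m x] inside the set; lattice invariance then
    reaches every [y] with the same class. *)
Lemma connectedA_range (R : realType) n (f : 'M[R]_n) :
  connectedA [set y | exists x, eqA y (f *m x)].
Proof.
move=> U1 U2 inv1 inv2 op1 op2.
set C := (X in X `<=` _); move=> sCU CU0.
have C0 : C 0 by exists 0; move=> i; rewrite mulmx0 subrr mxE.
have line (V1 V2 : set 'cV[R]_n) : lat_inv V1 -> open V1 -> open V2 ->
    C `<=` V1 `|` V2 -> C `&` V1 `&` V2 = set0 -> V1 0 -> C `<=` V1.
  move=> inv o1 o2 sC V0 V10 y [x yx].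
  pose l (t : R) : 'cV[R]_n := t *: (f *m x).
  have Cl t : C (l t).
    by exists (t *: x) => i; rewrite /l scalemxAr subrr mxE.
  have cl : continuous l by move=> t; apply: scalel_continuous.
  have oV (V : set 'cV[R]_n) : open V -> open (l @^-1` V).
    by move=> oV; apply: open_comp => // t _; apply: cl.
  have E : l @^-1` V1 = setT.
    have /connected_intervalP cT : is_interval [set: R] by [].
    (* The preimage of [V1] is nonempty, open, and closed as the complement of the preimage of
       [V2]. *)
    apply: cT.
    - by exists 0; rewrite /preimage /= /l scale0r.
    - by exists (l @^-1` V1); [exact: oV | rewrite setTI].
    - exists (~` (l @^-1` V2)); first by apply: open_closedC; exact: oV.
      rewrite setTI; apply/seteqP; split=> t /=.
        by move=> V1t V2t; have : set0 (l t) by rewrite -V0.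
      by case: (sC _ (Cl t)).
  have : (l @^-1` V1) 1 by rewrite E.
  rewrite /preimage /= /l scale1r; apply: inv => i.
  by rewrite -opprB mxE rpredN.
have [U10|U20] := sCU _ C0; [left|right].
  exact: (line U1 U2).
by apply: (line U2 U1) => //; rewrite 1?setUC// setIAC.
Qed.

Lemma latticeB (R : realType) n (x y : 'cV[R]_n) :
  lattice x -> lattice y -> lattice (x - y).
Proof. by move=> Lx Ly i; rewrite !mxE rpredB. Qed.

Lemma latticeD (R : realType) n (x y : 'cV[R]_n) :
  lattice x -> lattice y -> lattice (x + y).
Proof. by move=> Lx Ly i; rewrite !mxE rpredD. Qed.

Lemma eqA_sym (R : realType) n (x y : 'cV[R]_n) : eqA x y -> eqA y x.
Proof. by move=> xy i; rewrite -opprB mxE rpredN. Qed.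

Lemma eqA_trans (R : realType) n (x y z : 'cV[R]_n) :
  eqA x y -> eqA y z -> eqA x z.
Proof. by move=> xy yz; rewrite /eqA -(subrKA y); apply: latticeD. Qed.

Lemma lattice_small (R : realType) n (x : 'cV[R]_n) :
  lattice x -> (forall i, `|x i 0| < 2^-1) -> x = 0.
Proof.
move=> Lx x0; apply/colP=> i; rewrite mxE; apply/eqP; apply: contraT => xi0.
have := norm_intr_ge1 (Lx i) xi0; rewrite leNgt => /negP[].
by apply: lt_trans (x0 i) _; rewrite invf_lt1 ?ltr0n ?ltr1n.
Qed.

(* On S the map B takes values in Z^n, so it separates the classes of S modulo
   Z^n + ker B into relatively open and closed pieces. *)
Lemma component0_ker (R : realType) n (f B : 'M[R]_n) (S : set 'cV[R]_n) :
  (forall z : 'cV[R]_n, lattice z -> lattice (B *m z)) ->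
  (forall y, S y -> lattice (B *m y)) ->
  (forall y : 'cV[R]_n, B *m y = 0 -> exists x, y = f *m x) ->
  (forall x y, eqA y (f *m x) -> S y) ->
  component0 S = [set y | exists x, eqA y (f *m x)].
Proof.
move=> Bint BS Bker fS; apply/seteqP; split=> [y [C [CS [Cinv [C0 Cconn]]] Cy]|y fy].
  pose box (a : 'cV[R]_n) : set 'cV[R]_n :=
    [set y | forall i, `|(B *m y - a) i 0| < 2^-1].
  have box_inv a u v : box a u -> box (a - B *m (u - v)) v.
    move=> bu; rewrite /box /=.
    suff -> : B *m v - (a - B *m (u - v)) = B *m u - a by [].
    by rewrite mulmxBr opprB addrA [B *m v + _]addrC subrK.
  (* [U1] gathers the boxes centred in [B Z^n], [U2] those centred at the other lattice points. As
     [B] is integral, both are lattice-invariant; the radius 1/2 lets a box meet [S] only where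
     [B u] is its centre. *)
  pose U1 := \bigcup_(z in @lattice R n) box (B *m z).
  pose NB : set 'cV[R]_n :=
    [set w | lattice w /\ forall z, lattice z -> w <> B *m z].
  pose U2 := \bigcup_(w in NB) box w.
  have boxS a u : S u -> lattice a -> box a u -> B *m u = a.
    move=> Su La bu; apply/subr0_eq/lattice_small => //.
    exact: latticeB (BS _ Su) La.
  have [||||||sU1|sU2] := Cconn U1 U2.
  - move=> u v uv [z Lz bz]; exists (z - (u - v)); first exact: latticeB.
    by rewrite mulmxBr; apply: box_inv.
  - move=> u v uv [w [Lw nw] bw]; exists (w - B *m (u - v)); last exact: box_inv.
    split=> [|z Lz wz]; first by apply: latticeB => //; apply: Bint.
    apply: (nw (z + (u - v))); first exact: latticeD.
    by rewrite mulmxDr -wz subrK.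
  - by apply: bigcup_open => a _; apply: open_box.
  - by apply: bigcup_open => a _; apply: open_box.
  - move=> u /CS Su.
    have bu : box (B *m u) u by move=> i; rewrite subrr mxE normr0 invr_gt0 ltr0n.
    have [[z Lz uz]|nz] := pselect (exists2 z, lattice z & B *m u = B *m z).
      by left; exists z => //; rewrite -uz.
    right; exists (B *m u) => //; split; first exact: BS.
    by move=> z Lz uz; apply: nz; exists z.
  - apply/seteqP; split=> // u [[/CS Su [z Lz bz]] [w [Lw nw] bw]].
    by apply: (nw z Lz); rewrite -(boxS _ _ Su Lw bw) (boxS _ _ Su (Bint _ Lz) bz).
  (* Here [B y = B z] with [z] in the lattice, so [y - z] lies in the kernel of [B]. *)
  - have [z Lz bz] := sU1 _ Cy.
    have /eqP := boxS _ _ (CS _ Cy) (Bint _ Lz) bz.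
    rewrite -subr_eq0 -mulmxBr => /eqP/Bker[x yx]; exists x.
    by rewrite /eqA -yx opprB addrC subrK.
  (* This case is void: 0 lies in [C], and [B 0] is the image of the lattice vector 0. *)
  - have [w [Lw nw] bw] := sU2 _ C0.
    case: (nw 0) => [i|]; first by rewrite mxE.
    by rewrite -(boxS _ _ (CS _ C0) Lw bw) mulmx0.
(* Conversely, the image of [f] is itself one of the connected sets whose union is the component. *)
exists [set y | exists x, eqA y (f *m x)] => //; split=> [u [x]|]; first exact: fS.
split; first by move=> u v uv [x ux]; exists x; apply: eqA_trans ux; apply: eqA_sym.
split; first by exists 0 => i; rewrite mulmx0 subrr mxE.
exact: connectedA_range.
Qed.

(** * Denominators and integrality *)

Lemma ratmxRM (R : realType) n (a b : 'M[rat]_n) :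
  ratmxR R (a *m b) = ratmxR R a *m ratmxR R b.
Proof. exact: map_mxM. Qed.

Lemma ratmxRZ (R : realType) n (q : rat) (a : 'M[rat]_n) :
  ratmxR R (q *: a) = ratr q *: ratmxR R a.
Proof. exact: map_mxZ. Qed.

(** [x] ranges over a real vector space, which absorbs the nonzero factor [den_mx a]. *)
Lemma ImQE (R : realType) n (a : 'M[rat]_n) :
  ImQ (R := R) a = [set y | exists x, eqA y (ratmxR R a *m x)].
Proof.
have d0 : (den_mx a)%:R != 0 :> R.
  rewrite pnatr_eq0 -lt0n prodn_gt0// => i; rewrite prodn_gt0// => j.
  by rewrite absz_gt0 denq_neq0.
have dE x : ratmxR R ((den_mx a)%:R *: a) *m x =
    ratmxR R a *m ((den_mx a)%:R *: x).
  by rewrite ratmxRZ rmorph_nat -scalemxAl -scalemxAr.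
apply/seteqP; split=> y [x yx]; first by exists ((den_mx a)%:R *: x); rewrite -dE.
by exists ((den_mx a)%:R^-1 *: x); rewrite dE scalerA mulfV// scale1r.
Qed.

Lemma common_denominator (I : finType) (q : I -> rat) :
  exists2 N : nat, (0 < N)%N & forall i, N%:R * q i \is a Num.int.
Proof.
exists (\prod_i `|denq (q i)|)%N => [|i].
  by rewrite prodn_gt0// => i; rewrite absz_gt0 denq_neq0.
rewrite (bigD1 i)//= natrM mulrAC rpredM ?natr_int//.
by rewrite natr_absz gtr0_norm ?denq_gt0// mulrC -numqE intr_int.
Qed.

Lemma ratr_is_int (R : realType) (q : rat) :
  q \is a Num.int -> (ratr q : R) \is a Num.int.
Proof. by case/intrP=> z ->; rewrite ratr_int intr_int. Qed.

Lemma latticeZ (R : realType) n (a : R) (x : 'cV[R]_n) :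
  a \is a Num.int -> lattice x -> lattice (a *: x).
Proof. by move=> ai Lx i; rewrite mxE rpredM. Qed.

Lemma lattice_sum (R : realType) n (I : Type) (r : seq I) (P : pred I)
    (F : I -> 'cV[R]_n) :
  (forall i, P i -> lattice (F i)) -> lattice (\sum_(i <- r | P i) F i).
Proof. by move=> LF j; rewrite summxE rpred_sum// => i /LF. Qed.

Lemma lattice_mulmx (R : realType) n (M : 'M[R]_n) (x : 'cV[R]_n) :
  (forall i j, M i j \is a Num.int) -> lattice x -> lattice (M *m x).
Proof. by move=> Mi Lx i; rewrite mxE rpred_sum// => j _; rewrite rpredM. Qed.

(** * The common eigenspace of the [qD] and its component of 0 *)

Theorem theorem4p3
  (R : realType) (n : nat) (J : 'M[R]_n) (hA : is_abelian_variety J)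
  (gT : finGroupType) (G H : {group gT}) (sHG : H \subset G)
  (rho : gT -> 'M[int]_n)
  (rho1 : rho 1%g = 1%:M)
  (rhoM : {in G &, forall x y, rho (x * y)%g = rho x *m rho y})
  (rhoJ : forall x, x \in G -> is_endo J (rho x))
  (i : Iirr G)
  (hfixH : \rank (rfix_mx 'Chi_i H) = 1%N)
  (c : gT -> rat) (hc : forall g, g \in G -> ratr (c g) = 'chi_i g) :
  let qR (D : {set gT}) := ratmxR R (qD rho H D) in
  let cD (D : {set gT}) : rat := (#|H|%:R)^-1 * \sum_(y in D) c y in
  let UH := tangentQ (R:=R) (pH rho H) in
  (forall D, D \in dcosets H G ->
     (#|H|%:R)^-1 * \sum_(y in D) 'chi_i y \is a Num.int) /\
  (forall D, D \in dcosets H G ->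
     (forall u, UH u -> UH (qR D *m u)) /\
     (forall u, UH u -> lattice u -> lattice (qR D *m u))) /\
  ImQ (R:=R) (fHW rho G H c) =
    component0
      [set y | exists u, UH u /\ eqA y u /\
         (forall D, D \in dcosets H G -> eqA (qR D *m u) (ratr (cD D) *: u))].
Proof.
move=> qR cD UH.
have qRE D : D \in dcosets H G -> ratmxR R (pH rho H) *m qR D = qR D.
  by move=> DD; rewrite /qR -ratmxRM (pH_qD sHG rhoM DD).
(* [qRE] for [D = H] is the idempotence of [pH]. *)
have UHid u : UH u -> ratmxR R (pH rho H) *m u = u.
  move=> [x ->]; rewrite mulmxA; congr (_ *m x).
  exact: (qRE H (group_dcoset _ _)).
split; first by move=> D DD; exact: (chi_dcoset_int sHG hfixH hc DD).
split.
  move=> D DD; split=> u Uu.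
    by exists (qR D *m u); rewrite mulmxA qRE.
  have [M qM] := qD_transversal sHG rhoM DD.
  move=> Lu; rewrite /qR qM ratmxRM -mulmxA UHid//.
  by apply: lattice_mulmx => // k l; rewrite !mxE ratr_int intr_int.
have [b fb b1] := fHW_comb sHG rhoM hfixH hc.
set f := fHW rho G H c in fb *.
(* [N1] clears the coefficients [b D], and [N2] the entries of [f]. *)
have [N1 N10 N1b] := common_denominator b.
have [N2 N20 N2f] := common_denominator (fun kl => f kl.1 kl.2).
pose N := (N1 * N2)%N.
have Nb D : ratr (N%:R * b D) \is a @Num.int R.
  by apply: ratr_is_int; rewrite natrM mulrAC rpredM ?natr_int.
pose B : 'M[R]_n := N%:R *: (ratmxR R f - 1%:M).
have BE u : B *m u =
    \sum_(D in dcosets H G) ratr (N%:R * b D) *: (qR D *m u - ratr (cD D) *: u).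
  rewrite -scalemxAl mulmxBl mul1mx.
  under eq_bigr do rewrite rmorphM rmorph_nat -scalerA scalerBr.
  rewrite -scaler_sumr; congr (_ *: _); rewrite sumrB; congr (_ - _).
    rewrite fb /ratmxR raddf_sum mulmx_suml; apply: eq_bigr => D _.
    by rewrite /= map_mxZ -scalemxAl.
  under eq_bigr do rewrite scalerA -rmorphM.
  by rewrite -scaler_suml -rmorph_sum b1 rmorph1 scale1r.
have Bint (z : 'cV[R]_n) : lattice z -> lattice (B *m z).
  apply: lattice_mulmx => k l; rewrite !mxE mulrBr rpredB//; last by rewrite rpredM ?natr_int.
  rewrite /N natrM -mulrA rpredM ?natr_int//.
  have := ratr_is_int R (N2f (k, l)).
  by rewrite rmorphM rmorph_nat /f /fHW /= mxE.
rewrite ImQE; symmetry; apply: (@component0_ker _ _ _ B) => //.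
- move=> y [u [Uu [yu uD]]].
  (* [y - u] is a lattice vector, handled by [Bint]; on [u] the equations make [BE] an integral
     combination of lattice vectors. *)
  rewrite -[y](subrK u) mulmxDr; apply: latticeD; first exact: Bint.
  by rewrite BE; apply: lattice_sum => D DD; apply: latticeZ => //; apply: uD.
- move=> y /eqP; rewrite -scalemxAl scaler_eq0 pnatr_eq0 muln_eq0.
  rewrite !eqn0Ngt N10 N20 /= mulmxBl mul1mx subr_eq0 => /eqP yf.
  by exists y.
(* The point [f x] lies in [UH] because [f] is [pH] times [eW], and it satisfies the equations
   exactly, not only modulo the lattice. *)
- move=> x y yfx; exists (ratmxR R f *m x); split; last split=> // D DD.
    by exists (ratmxR R (eW rho G c) *m x); rewrite mulmxA -ratmxRM.
  have -> : qR D *m (ratmxR R f *m x) = ratr (cD D) *: (ratmxR R f *m x).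
    rewrite mulmxA -ratmxRM (qD_fHW sHG rhoM hfixH hc DD).
    by rewrite ratmxRZ -scalemxAl.
  by move=> k; rewrite subrr mxE.
Qed.
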